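(* Let $f,g:\mathbb{R}^{N}\rightarrow (-\infty ,\infty ]$ be Borel measurable, and suppose there are constants $c>0$ and $\alpha>0$ such that $f(x)\geq c|x|^{\alpha }$ and $g(x)\geq c|x|^{\alpha }$ for $|x|$ large enough. Let $m_f:=\inf f$, $m_g:=\inf g$, $f_+:=\max\{f,0\}$, $m_{f_+}:=\inf f_+$. Then: (i) If $m_{f},m_{g}\in \mathbb{R}$ and $m_{f}+m_{g}>0$, then $(f\Box g)^{-1}\in L^{p}(\mathbb{R}^N)$ for every $p\geq 1$ with $p>N/\alpha$. (ii) If $g\geq 0$ and $m_{f_{+}}+m_{g}>0$, then $(f\veebar g)^{-1}\in L^{p}(\mathbb{R}^N)$ for every $p\geq 1$ with $p>N/\alpha$.
   Context: $(f\Box g)(x):=\inf_{y}(f(x-y)+g(y))$ and $(f\veebar g)(x):=\inf_{y}\max\{f(x-y),g(y)\}$. For $h\ge0$, $h^{-1}:=1/h$ (with $1/0=\infty$, $1/\infty=0$). *)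

(* Defs.v *)
From HB Require Import structures.
From mathcomp Require Import all_boot all_order all_algebra.
From mathcomp Require Import all_classical all_reals all_analysis.
From mathcomp Require Import measurable_realfun.
Set Implicit Arguments.
Unset Strict Implicit.
Unset Printing Implicit Defensive.
Import Order.TTheory GRing.Theory Num.Theory.
Import numFieldNormedType.Exports.
Local Open Scope classical_set_scope.
Local Open Scope ring_scope.

(** Euclidean space R^N (N >= 1), modelled as nested pairs
    R^1 = R, R^(n+2) = R * R^(n+1), with its Borel sigma-algebra
    (the product of the Borel sigma-algebras of R), Lebesgue measure
    (the product of the 1-dimensional Lebesgue measures, restricted to
    Borel sets), vector subtraction, and squared Euclidean norm. *)
Record euc_space (R : realType) := EucSpace {
  euc_disp : measure_display;
  euc_car : measurableType euc_disp;
  euc_leb : {measure set euc_car -> \bar R};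
  euc_sub : euc_car -> euc_car -> euc_car;
  euc_sqnorm : euc_car -> R }.

Fixpoint euc_aux (R : realType) (n : nat) : euc_space R :=
  match n with
  | 0 => @EucSpace R _ (measurableTypeR R) (@lebesgue_measure R)
           (fun x y : R => x - y) (fun x : R => x ^+ 2)
  | n'.+1 =>
    let E := euc_aux R n' in
    @EucSpace R _ (measurableTypeR R * euc_car E)%type
      (@lebesgue_measure R \x^ euc_leb E)%E
      (fun x y => (x.1 - y.1, euc_sub x.2 y.2))
      (fun x => x.1 ^+ 2 + euc_sqnorm x.2)
  end.

Definition RN (R : realType) (N : nat) : euc_space R := euc_aux R N.-1.

Definition euc_norm (R : realType) (E : euc_space R) (x : euc_car E) : R :=
  Num.sqrt (euc_sqnorm x).

Local Open Scope ereal_scope.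

Definition infconv (R : realType) (E : euc_space R)
  (f g : euc_car E -> \bar R) (x : euc_car E) : \bar R :=
  ereal_inf [set f (euc_sub x y) + g y | y in [set: euc_car E]].

Definition maxconv (R : realType) (E : euc_space R)
  (f g : euc_car E -> \bar R) (x : euc_car E) : \bar R :=
  ereal_inf [set maxe (f (euc_sub x y)) (g y) | y in [set: euc_car E]].

(** h^{-1} := 1/h for h >= 0, with 1/0 = +oo and 1/+oo = 0
    (the value at -oo is irrelevant and set to 0) *)
Definition einv (R : realType) (a : \bar R) : \bar R :=
  match a with
  | r%:E => if r == 0%R then +oo else (r^-1)%:E
  | _ => 0
  end.

(** h belongs to L^p(R^N) (Lebesgue sense): h agrees Lebesgue-a.e. with a
    Borel measurable function k whose L^p norm is finite. *)
Definition inLp (R : realType) (E : euc_space R) (h : euc_car E -> \bar R)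
  (p : R) : Prop :=
  exists k : euc_car E -> \bar R,
    [/\ measurable_fun [set: euc_car E] k,
        {ae euc_leb E, forall x, h x = k x}
      & Lnorm (euc_leb E) p%:E k < +oo].

(* Main.v *)
(** The sublevel set [{f Box g < q}] is the projection on [x] of the Borel set
    [{(x, y) | f (x - y) + g y < q}], so it need not be Borel, but it is
    analytic. Parametrizing the points [y] of R^N by a Borel image of the Baire
    space turns the projection into a Suslin set
    [{x | exists s, forall j, A j s x}] where [A j s] is measurable and depends
    on finitely many values of [s]. For a finite sequence [s], let [H s] be a
    measurable hull of the part of that set witnessed by extensions of [s];
    each [H s `\` \bigcup_n H (rcons s n)] is null, and outside these countably
    many null sets a point of [H [::]] can be followed down to a witness. Hence
    the Suslin set is measurable up to a null set, and the infimal convolution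
    agrees almost everywhere with a Borel function.

    For integrability, [|x|^2 <= 2 |x - y|^2 + 2 |y|^2] shows that [x - y] or
    [y] has norm at least [|x| / 2], so the growth of [f] and [g] and the
    positive lower bound give [F x >= c' * max(1, |x|)^alpha]. The integral of
    [F^-p] over dyadic shells is then dominated by a geometric series of ratio
    [2^(N - alpha p) < 1]. *)
From HB Require Import structures.
Require Import Defs.
From mathcomp Require Import all_boot all_order all_algebra.
From mathcomp Require Import all_classical all_reals all_analysis.
From mathcomp Require Import measurable_realfun.
From mathcomp Require Import ring lra.
Import Order.TTheory GRing.Theory Num.Theory.
Local Open Scope classical_set_scope.
Local Open Scope ring_scope.

(** * Measurable hulls and Suslin sets *)

Section measurable_hull.
Local Open Scope ereal_scope.
Context d (T : measurableType d) (R : realType).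
Context (mu : {measure set T -> \bar R}).

Definition is_hull (E H : set T) := [/\ measurable H, E `<=` H &
  forall B, measurable B -> E `<=` B -> mu (H `\` B) = 0].

(** The intersection of measurable supersets of [E] whose measures approach the infimum [m] has
    measure [m]. Cutting it by a measurable [C] containing [E] leaves measure at least [m], so by
    finiteness nothing of positive measure is lost. *)
Lemma finite_measure_hull (E F : set T) : measurable F -> mu F < +oo ->
  E `<=` F -> exists H, is_hull E H.
Proof.
move=> mF Foo EF.
pose S := [set mu B | B in [set B | measurable B /\ E `<=` B]].
pose m := ereal_inf S.
have m0 : 0 <= m by apply: le_ereal_inf_tmp => _ [B [mB _] <-].
have mfin : m \is a fin_num.
  rewrite ge0_fin_numE//; apply: le_lt_trans Foo; apply: ereal_inf_lbound.
  by exists F.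
have approx n : exists B, [/\ measurable B, E `<=` B & mu B < m + n.+1%:R^-1%:E].
  have e0 : (0 < n.+1%:R^-1 :> R)%R by rewrite invr_gt0.
  have [_ [B [mB EB] <-] Bm] := lb_ereal_inf_adherent e0 mfin.
  by exists B.
have [B /all_and3 [mB EB Bm]] := choice approx.
have mH : measurable (\bigcap_n B n) by exact: bigcapT_measurable.
exists (\bigcap_n B n); split => //; first by move=> x Ex n _; exact: EB.
move=> C mC EC.
have Hm : mu (\bigcap_n B n) <= m.
  apply/lee_addgt0Pr => e e0.
  near \oo => n.
  apply: (@le_trans _ _ (mu (B n))).
    by apply: le_measure; rewrite ?inE//; apply: bigcap_inf.
  apply: (le_trans (ltW (Bm n))); rewrite leeD2l// lee_fin.
  apply: ltW; near: n; exact: near_infty_natSinv_lt (PosNum e0).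
have mHC : m <= mu (\bigcap_n B n `&` C).
  apply: ereal_inf_lbound; exists (\bigcap_n B n `&` C) => //; split.
    exact: measurableI.
  by move=> x Ex; split; [move=> n _; exact: EB|exact: EC].
have Hoo : mu (\bigcap_n B n) < +oo by apply: le_lt_trans Hm _; rewrite ltey_eq mfin.
apply/eqP; rewrite -measure_le0 measureD//.
rewrite leeBlDr ?add0e; first exact: le_trans Hm mHC.
rewrite ge0_fin_numE//; apply: le_lt_trans Hoo; apply: le_measure; rewrite ?inE//.
exact: measurableI.
Unshelve. all: by end_near. Qed.

Lemma sigma_finite_hull (E : set T) : sigma_finite setT mu ->
  exists H, is_hull E H.
Proof.
move=> [F FT mF].
have /choice [H hH] n : exists H, is_hull (E `&` F n) H.
  by have [? ?] := mF n; apply: (@finite_measure_hull _ (F n)) => // x [].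
exists (\bigcup_n H n); split.
- by apply: bigcupT_measurable => n; have [] := hH n.
- move=> x Ex; have [n _ Fx] : (\bigcup_n F n) x by rewrite -FT.
  by exists n => //; have [_ + _] := hH n; apply.
- move=> B mB EB; rewrite setD_bigcupl.
  apply: measure_negligible.
    apply: bigcupT_measurable => n; apply: measurableD => //.
    by have [] := hH n.
  apply: negligible_bigcup => n; have [mH _ H0] := hH n.
  apply/negligibleP; first exact: measurableD.
  by apply: H0 => // x [/EB].
Qed.

End measurable_hull.

(** Exchanging [s] and [s'] turns the inclusion into an equality. *)
Definition finitary T (A : (nat -> nat) -> set T) := exists N, forall s s',
  (forall i, (i < N)%N -> s i = s' i) -> A s `<=` A s'.

Section suslin.
Context d (T : measurableType d) (R : realType).
Context (mu : {measure set T -> \bar R}).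

Lemma suslin_sandwich (A : nat -> (nat -> nat) -> set T) :
  sigma_finite setT mu ->
  (forall j s, measurable (A j s)) -> (forall j, finitary _ (A j)) ->
  let E := [set x | exists s, forall j, A j s x] in
  exists H, [/\ measurable H, E `<=` H & mu.-negligible (H `\` E)].
Proof.
move=> sf mA /choice[N AN] E.
pose Es (s : seq nat) := [set x | exists t, (forall i, (i < size s)%N ->
   t i = nth 0%N s i) /\ forall j, A j t x].
(* The conditions already decided by the prefix [s]; the padding by 0 is never read. *)
pose Ms (s : seq nat) :=
  \bigcap_(j in [set j | (N j <= size s)%N]) A j (nth 0%N s).
have EM s : Es s `<=` Ms s.
  move=> x [t [ts Ax]] j /= Nj; apply: (AN j t) => // i iN.
  by apply: ts; exact: leq_trans iN Nj.
have mM s : measurable (Ms s) by exact: bigcap_measurableType.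
have /choice [K hK] s : exists H, is_hull _ _ _ mu (Es s) H.
  exact: sigma_finite_hull.
(* Cutting the hull by [Ms s] ensures that a branch staying inside [H] satisfies every [A j]. *)
pose H s := K s `&` Ms s.
have mH s : measurable (H s) by have [? _ _] := hK s; exact: measurableI.
have EH s : Es s `<=` H s.
  by move=> x Ex; split; [have [_ + _] := hK s; apply|exact: EM].
pose D s := H s `\` \bigcup_n H (rcons s n).
have mU s : measurable (\bigcup_n H (rcons s n)) by exact: bigcupT_measurable.
have nD s : mu.-negligible (D s).
  have [mK _ K0] := hK s.
  (* The children of [s] cover [Es s], so the hull property of [K s] applies to the union of their
     [H]. *)
  exists (K s `\` \bigcup_n H (rcons s n)); split.
  - exact: measurableD.
  - apply: K0 => // x [t [ts Ax]]; exists (t (size s)) => //; apply: EH.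
    exists t; split => // i; rewrite size_rcons nth_rcons ltnS leq_eqVlt.
    by case/orP=> [/eqP ->|si]; [rewrite ltnn eqxx|rewrite si ts].
  - by move=> x [[]].
exists (H [::]); split => //.
  by move=> x [t Ax]; apply: EH; exists t.
(* Finite sequences are countable: [unpickle] enumerates them all. *)
apply: (@negligibleS _ _ _ _ (\bigcup_k D (odflt [::] (unpickle k)))); last first.
  exact: negligible_bigcup.
move=> x [Hx nEx]; apply: contrapT => nDx; apply: nEx.
have /choice[c hc] s : exists n, H s x -> H (rcons s n) x.
  have [Hsx|] := pselect (H s x); last by exists 0%N.
  have [[n _ Hn]|nU] := pselect ((\bigcup_n H (rcons s n)) x); first by exists n.
  by by case: nDx; exists (pickle s); rewrite // pickleK.
pose p n := iter n (fun s => rcons s (c s)) [::].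
pose t n := c (p n).
have pE n : p n = mkseq t n.
  by elim: n => // n IH; rewrite mkseqS -IH.
have Hp n : H (p n) x by elim: n => // n IH; exact: hc.
(* [A j] reads only the first [N j] values of the branch, so stage [N j] decides it. *)
exists t => j; have [_ Mx] := Hp (N j).
apply: (AN j (nth 0%N (p (N j)))) => [i iN|].
  by rewrite pE nth_mkseq.
by apply: Mx; rewrite /= pE size_mkseq.
Qed.

End suslin.

(** * Projections of measurable sets *)

Definition cylinders : set (set (nat -> nat)) :=
  [set C | exists i j, C = [set t | t i = j]].

(** Fixing single coordinates generates the Borel sigma-algebra of the Baire space. *)
Definition baire := g_sigma_algebraType cylinders.
HB.instance Definition _ := Measurable.on baire.

Lemma finitary_comp T (A : (nat -> nat) -> set T) (h : nat -> nat) :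
  finitary T A -> finitary T (fun r => A (r \o h)).
Proof.
move=> [N AN]; exists (\max_(i < N) h i).+1 => s s' ss'; apply: AN => i iN.
by apply: ss'; rewrite ltnS (leq_bigmax (Ordinal iN)).
Qed.

Section projection.
Context d (T : measurableType d).
Implicit Types W : set (T * baire).

Let measurable_constant_prop (P : Prop) : measurable [set x : T | P].
Proof.
have [p|np] := pselect P.
  by rewrite (propT p); exact: (@measurableT _ T).
by rewrite (propF np); exact: (@measurable0 _ T).
Qed.

(* The even coordinates of [r] carry the parameter of the Baire space, the odd
   ones carry the existential witness. *)
Definition analytic W := exists A : nat -> (nat -> nat) -> set T,
  [/\ forall j r, measurable (A j r), forall j, finitary T (A j)
    & forall x (t : baire),
      W (x, t) <-> exists r, (forall i, r i.*2 = t i) /\ forall j, A j r x].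

Lemma finitary_analytic (B : (nat -> nat) -> set T) :
  (forall t, measurable (B t)) -> finitary T B ->
  analytic [set w | B w.2 w.1].
Proof.
move=> mB fB; exists (fun=> fun r => B (r \o double)); split => //.
  by move=> _; exact: finitary_comp.
move=> x t /=; split=> [Bt|[r [rt /(_ 0%N)]]]; last first.
  by congr (B _ x); apply/funext => i; exact: rt.
have e : (fun n => t n./2) \o double = t.
  by apply/funext => i /=; rewrite doubleK.
exists (fun n => t n./2); rewrite e; split => // i.
by rewrite doubleK.
Qed.

(** Countably many witnesses are packed into one: the [i]-th odd coordinate of the [m]-th witness
    sits at the odd position coded by [pickle (m, i)], and [h m] reads it back. The conditions are
    likewise indexed by codes of pairs. *)
Lemma analytic_bigcap (W : (set (T * baire))^nat) :
  (forall n, analytic (W n)) -> analytic (\bigcap_n W n).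
Proof.
move=> /choice[A /all_and3[mA fA WA]].
pose h (m n : nat) := if odd n then (pickle (m, n./2)).*2.+1 else n.
pose dec p : nat * nat := odflt (0, 0)%N (unpickle p).
have decK (m i : nat) : dec (pickle (m, i)) = (m, i) by rewrite /dec pickleK.
exists (fun p r => A (dec p).1 (dec p).2 (r \o h (dec p).1)); split => //.
  by move=> p; apply: finitary_comp.
move=> x t; split=> [Wx|[r [rt Ar]] m _].
  have /choice[r hr] m := (WA m x t).1 (Wx m I).
  pose s n := if odd n then r (dec n./2).1 (dec n./2).2.*2.+1 else t n./2.
  exists s; split=> [i|p]; first by rewrite /s odd_double doubleK.
  have -> : s \o h (dec p).1 = r (dec p).1; last by have [_] := hr (dec p).1.
  apply/funext => n; rewrite /s /h /=; have [on|en] := boolP (odd n).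
    rewrite /= odd_double /= uphalf_double decK /=.
    by rewrite -[in RHS](odd_double_half n) on.
  rewrite (negbTE en); have [<- _] := hr (dec p).1.
  by rewrite -[in RHS](odd_double_half n) (negbTE en).
apply/(WA m x t); exists (r \o h m); split=> [i|j].
  by rewrite /= /h odd_double rt.
by have := Ar (pickle (m, j)); rewrite decK.
Qed.

(** Coordinate 1 of the witness names the index of a set containing the point; the conditions of the
    other sets become vacuous. The remaining odd coordinates are shifted by two to make room. *)
Lemma analytic_bigcup (W : (set (T * baire))^nat) :
  (forall n, analytic (W n)) -> analytic (\bigcup_n W n).
Proof.
move=> /choice[A /all_and3[mA fA WA]].
pose h (n : nat) := if odd n then n.+2 else n.
pose dec p : nat * nat := odflt (0, 0)%N (unpickle p).
have decK (m i : nat) : dec (pickle (m, i)) = (m, i) by rewrite /dec pickleK.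
exists (fun p r => [set x | r 1%N = (dec p).1 ->
  A (dec p).1 (dec p).2 (r \o h) x]); split.
- move=> p r; have [e|ne] := pselect (r 1%N = (dec p).1).
    rewrite [X in measurable X](_ : _ = A (dec p).1 (dec p).2 (r \o h)) //.
    by apply/seteqP; split=> [x /= /(_ e)|x Ax _].
  rewrite [X in measurable X](_ : _ = setT) //.
  by apply/seteqP; split=> // x _ /ne.
- move=> p; have [N hN] := finitary_comp _ _ h (fA (dec p).1 (dec p).2).
  (* The bound 2 accounts for reading coordinate 1. *)
  exists (maxn 2 N) => s s' ss' x /= As s'1.
  apply: (hN s s'); first by move=> i iN; apply: ss'; rewrite leq_max iN orbT.
  by apply: As; rewrite ss' ?leq_max.
move=> x t; split=> [[m _ /(WA m x t)[r [rt Ar]]]|[r [rt Ar]]].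
  pose s n := if n == 1%N then m else if odd n then r n.-2 else t n./2.
  exists s; split=> [i|p /= mp].
    rewrite /s odd_double doubleK; case: eqP => // /(congr1 odd).
    by rewrite odd_double.
  have -> : s \o h = r; last by move: mp; rewrite /s eqxx => <-.
  apply/funext => n; rewrite /s /h /=; have [on|en] := boolP (odd n).
    by rewrite /= negbK on.
  rewrite (negbTE en) ifF; last by apply: contraNF en => /eqP ->.
  by rewrite -rt -[in RHS](odd_double_half n) (negbTE en).
exists (r 1%N) => //; apply/(WA _ x t); exists (r \o h); split=> [i|j].
  by rewrite /= /h odd_double rt.
by have := Ar (pickle (r 1%N, j)); rewrite /= decK; apply.
Qed.

(** Requiring both halves builds in closure under complement, so these sets form a sigma-algebra and
    only generators need checking. *)
Definition bianalytic W := analytic W /\ analytic (~` W).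

Lemma bianalyticC W : bianalytic W -> bianalytic (~` W).
Proof. by move=> [? ?]; split => //; rewrite setCK. Qed.

Lemma bianalytic_bigcup (W : (set (T * baire))^nat) :
  (forall n, bianalytic (W n)) -> bianalytic (\bigcup_n W n).
Proof.
move=> bW; split; first by apply: analytic_bigcup => n; have [] := bW n.
by rewrite setC_bigcup; apply: analytic_bigcap => n; have [] := bW n.
Qed.

Lemma finitary_bianalytic (B : (nat -> nat) -> set T) :
  (forall t, measurable (B t)) -> finitary T B ->
  bianalytic [set w | B w.2 w.1].
Proof.
move=> mB fB; split; first exact: finitary_analytic.
apply: (finitary_analytic (fun t => ~` B t)) => [t|]; first exact: measurableC.
case: fB => N BN; exists N => s s' ss' x nB; apply: contra_not nB.
by apply: BN => i iN; rewrite ss'.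
Qed.

(** Two nested inductions over generated sigma-algebras: first over the product, then, for preimages
    of sets in the Baire factor, over the cylinders. *)
Lemma measurable_bianalytic W : measurable W -> bianalytic W.
Proof.
have bT (P : Prop) : bianalytic [set w | P].
  apply: (finitary_bianalytic (fun=> [set x | P])); last by exists 0%N => s s' _ x.
  by move=> _; exact: measurable_constant_prop.
apply: smallest_sub.
  split.
  - exact: (bT False).
  - by move=> A; rewrite setTD; exact: bianalyticC.
  - by move=> A; exact: bianalytic_bigcup.
move=> _ [[B mB <-]|[B mB <-]]; rewrite setTI.
  by apply: (finitary_bianalytic (fun=> B)) => //; exists 0%N => s s' _ x.
move: B mB; apply: smallest_sub.
  split.
  - exact: (bT False).
  - by move=> A; rewrite setTD /= preimage_setC; exact: bianalyticC.
  - by move=> A bA /=; rewrite preimage_bigcup; exact: bianalytic_bigcup.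
move=> _ [i [j ->]] /=.
apply: (finitary_bianalytic (fun t => [set x | t i = j])) => [t|].
  exact: measurable_constant_prop.
by exists i.+1 => s s' ss' x /=; rewrite ss'.
Qed.

Lemma measurable_projection_sandwich (R : realType)
    (mu : {measure set T -> \bar R}) W :
  sigma_finite setT mu -> measurable W ->
  let E := [set x | exists t, W (x, t)] in
  exists H, [/\ measurable H, E `<=` H & mu.-negligible (H `\` E)].
Proof.
move=> sf /measurable_bianalytic[[A [mA fA WA]] _] E.
have -> : E = [set x | exists r, forall j, A j r x].
  apply/seteqP; split=> x /= [t].
    by move=> /(WA x t)[r [_ ?]]; exists r.
  (* A bare witness already carries a parameter in its even coordinates. *)
  by move=> At; exists (t \o double); apply/WA; exists t.
exact: suslin_sandwich.
Qed.

End projection.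

(** * Borel images of the Baire space *)

Definition baire_image d (Y : measurableType d) := exists phi : baire -> Y,
  measurable_fun setT phi /\ forall y, exists t, phi t = y.

Lemma measurable_reindex (h : nat -> nat) :
  measurable_fun setT (fun t : baire => (t \o h : baire)).
Proof.
apply: (@measurability _ _ baire baire setT _ cylinders) => //.
move=> _ [_ [i [j ->]] <-]; rewrite setTI.
by apply: sub_sigma_algebra; exists (h i), j.
Qed.

Lemma baire_image_prod d1 (Y1 : measurableType d1) d2 (Y2 : measurableType d2) :
  baire_image _ Y1 -> baire_image _ Y2 -> baire_image _ (Y1 * Y2)%type.
Proof.
move=> [p1 [mp1 sp1]] [p2 [mp2 sp2]].
exists (fun t => (p1 (t \o double), p2 (t \o (succn \o double)))); split.
  apply: measurable_fun_pair.
    exact: (measurableT_comp mp1 (measurable_reindex _)).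
  exact: (measurableT_comp mp2 (measurable_reindex _)).
move=> [y1 y2]; have [t1 <-] := sp1 y1; have [t2 <-] := sp2 y2.
exists (fun n => if odd n then t2 n./2 else t1 n./2).
by congr (p1 _, p2 _); apply/funext => n /=;
   rewrite odd_double /= ?doubleK ?uphalf_double.
Qed.

(* A real number is the supremum of a sequence of rationals. *)
Lemma baire_image_real (R : realType) : baire_image _ (measurableTypeR R).
Proof.
pose q n : R := ratr (odflt 0 (unpickle n)).
pose u (n : nat) (t : baire) := (q (t n))%:E.
have meas_u n : measurable_fun setT (u n).
  move=> _ B mB; rewrite setTI.
  rewrite [X in measurable X](_ : _ = \bigcup_(j in [set j | B (q j)%:E])
      [set t : baire | t n = j]); last first.
    apply/seteqP; split=> [t Bt|t [j /= Bj tj]]; first by exists (t n).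
    by rewrite /preimage /= /u tj.
  by apply: bigcup_measurable => j _; apply: sub_sigma_algebra; exists n, j.
exists (fun t => fine (esups (u ^~ t) 0)); split.
  apply: (measurableT_comp (fine_measurable measurableT)).
  exact: (measurable_fun_esups meas_u).
move=> y; have [n0 yn0] : exists n, q n < y.
  have yy : y - 1 < y by rewrite ltrBlDr ltrDl.
  have [r] := rat_in_itvoo yy; rewrite inE /= => /itvP ry.
  by exists (pickle r); rewrite /q pickleK /= ry.
(* Indices of rationals that are too large are replaced by the fixed admissible [n0], so the
   sequence runs through all rationals below [y]. *)
pose c n := if q n < y then n else n0.
have cy n : q (c n) < y by rewrite /c; case: ifPn.
exists c; have sup_le : (esups (fun n => u n c) 0%N <= y%:E)%E.
  by apply: ge_ereal_sup => _ [n _ <-]; rewrite lee_fin ltW.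
have le_sup n : ((q (c n))%:E <= esups (fun n => u n c) 0%N)%E.
  by apply: ereal_sup_ubound; exists n.
suff -> : esups (fun n => u n c) 0%N = y%:E by [].
apply/eqP; rewrite eq_le sup_le; apply/lee_addgt0Pr => e e0.
have ye : y - e < y by rewrite ltrBlDr ltrDl.
have [r] := rat_in_itvoo ye; rewrite inE /= => /itvP ry.
apply: (@le_trans _ _ ((q (c (pickle r)))%:E + e%:E)); last by rewrite leeD2r.
have qr : q (pickle r) = ratr r by rewrite /q pickleK.
by rewrite -EFinD lee_fin -lerBlDr /c qr ry qr ry.
Qed.

Lemma baire_image_RN (R : realType) N : baire_image _ (euc_car (RN R N)).
Proof.
rewrite /RN; elim: N.-1 => [|n IH]; first exact: baire_image_real.
exact: baire_image_prod (baire_image_real R) IH.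
Qed.

(** * Measurability of infima up to null sets *)

Lemma ereal_rat_dense (R : realType) (a b : \bar R) : (a < b)%E ->
  exists r : rat, (a < (ratr r)%:E < b)%E.
Proof.
have itv (x y : R) : x < y -> exists r : rat, x < ratr r < y.
  by move=> /rat_in_itvoo[r]; rewrite inE /= => /itvP xry; exists r; rewrite !xry.
case: a b => [a| |] [b| |] //=.
- by rewrite lte_fin => /itv[r]; exists r; rewrite !lte_fin.
- have aa : a < a + 1 by rewrite ltrDl.
  by have [r /andP[ar _]] := itv _ _ aa; exists r; rewrite lte_fin ar ltry.
- have bb : b - 1 < b by rewrite ltrBlDr ltrDl.
  by have [r /andP[_ rb]] := itv _ _ bb; exists r; rewrite lte_fin rb ltNyr.
- by exists 0; rewrite ltNyr ltry.
Qed.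

(** Each rational sublevel set of the infimum is a projection, hence agrees with a measurable [H n]
    up to a null set. Off these null sets, the infimum of the [q n] with [x] in [H n] is the infimum
    of the rationals above [F x], which is [F x]. *)
Lemma measurable_infimum_ae d (X : measurableType d) d' (Y : measurableType d')
    (R : realType) (mu : {measure set X -> \bar R}) (h : X * Y -> \bar R) :
  sigma_finite setT mu -> baire_image _ Y -> measurable_fun setT h ->
  exists k : X -> \bar R, measurable_fun setT k /\
    {ae mu, forall x, ereal_inf [set h (x, y) | y in setT] = k x}.
Proof.
move=> sf [phi [mphi sphi]] mh.
pose F x := ereal_inf [set h (x, y) | y in setT].
pose q n : R := ratr (odflt 0 (unpickle n)).
have /choice[H hH] n : exists H, [/\ measurable H,
    [set x | F x < (q n)%:E]%E `<=` H &
    mu.-negligible (H `\` [set x | F x < (q n)%:E]%E)].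
  pose hphi (w : X * baire) := h (w.1, phi w.2).
  have mhphi : measurable_fun setT hphi.
    apply: (measurableT_comp mh); apply: measurable_fun_pair => //.
    exact: (measurableT_comp mphi).
  have mW : measurable (hphi @^-1` `]-oo, (q n)%:E[%classic).
    by rewrite -[X in measurable X]setTI; apply: mhphi => //; exact: emeasurable_itv.
  suff -> : [set x | F x < (q n)%:E]%E = [set x | exists t,
      (hphi @^-1` `]-oo, (q n)%:E[%classic) (x, t)].
    exact: measurable_projection_sandwich.
  apply/seteqP; split=> [x /= /ereal_inf_lt[_ [y _ <-] hy]|x [t]].
    by have [t ty] := sphi y; exists t; rewrite /= in_itv /= /hphi /= ty.
  rewrite /= in_itv /=; apply: le_lt_trans; apply: ereal_inf_lbound.
  by exists (phi t).
(* The value [+oo] removes the index [n] from the infimum when [x] is outside [H n]. *)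
pose v n x := if x \in H n then (q n)%:E else +oo%E.
exists (fun x => einfs (v ^~ x) 0); split.
  apply: measurable_fun_einfs => n; have [mH _ _] := hH n.
  apply: measurable_fun_ifT => //; apply: (@measurable_fun_bool _ _ _ _ true).
  rewrite setTI [X in measurable X](_ : _ = H n) //.
  by apply/seteqP; split=> x /=; [move/set_mem|move/mem_set].
apply: (@negligibleS _ _ _ _ (\bigcup_n (H n `\` [set x | F x < (q n)%:E]%E))).
  move=> x /=; apply: contra_notP => nU; apply/eqP; rewrite eq_le.
  apply/andP; split.
    apply: le_ereal_inf_tmp => _ [n _ <-]; rewrite /v; case: ifPn; last by rewrite leey.
    move=> /set_mem Hn; apply: ltW; apply: contrapT => nF.
    by apply: nU; exists n.
  rewrite leNgt; apply/negP => /ereal_rat_dense[r /andP[Fr]].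
  rewrite ltNge => /negP; apply; apply: ereal_inf_lbound; exists (pickle r) => //.
  have qr : q (pickle r) = ratr r by rewrite /q pickleK.
  rewrite /v ifT; first by rewrite qr.
  by apply/mem_set; have [_ + _] := hH (pickle r); apply; rewrite /= qr.
by apply: negligible_bigcup => n; have [_ _] := hH n.
Qed.

(** * Euclidean balls *)

Section euclidean.
Context (R : realType).

Lemma measurable_euc_sub N : measurable_fun setT
  (fun w : euc_car (RN R N) * euc_car (RN R N) => euc_sub w.1 w.2).
Proof.
rewrite /RN; elim: N.-1 => [|n IH] /=.
  exact: (@measurable_funB _ _ R _ fst snd).
apply: measurable_fun_pair.
  apply: measurable_funB; exact: (measurableT_comp measurable_fst).
have m2 : measurable_fun setT
    (fun w : (measurableTypeR R * euc_car (euc_aux R n)) *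
             (measurableTypeR R * euc_car (euc_aux R n)) => (w.1.2, w.2.2)).
  apply: measurable_fun_pair; exact: (measurableT_comp measurable_snd).
exact: (measurableT_comp IH m2).
Qed.

Lemma measurable_euc_sqnorm N :
  measurable_fun setT (fun x : euc_car (RN R N) => euc_sqnorm x).
Proof.
rewrite /RN; elim: N.-1 => [|n IH] /=; first exact: measurable_funX.
apply: measurable_funD; first exact: measurable_funX.
exact: (measurableT_comp IH measurable_snd).
Qed.

Lemma euc_sqnorm_ge0 N (x : euc_car (RN R N)) : 0 <= euc_sqnorm x.
Proof.
rewrite /RN in x *; elim: N.-1 x => [|n IH] x /=; first exact: sqr_ge0.
by rewrite addr_ge0 ?sqr_ge0.
Qed.

Lemma euc_sqnorm_sub N (x y : euc_car (RN R N)) :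
  euc_sqnorm x <= 2 * (euc_sqnorm (euc_sub x y) + euc_sqnorm y).
Proof.
have sq (a b : R) : a ^+ 2 <= 2 * ((a - b) ^+ 2 + b ^+ 2).
  rewrite -subr_ge0 (_ : _ - _ = (a - 2 * b) ^+ 2) ?sqr_ge0//.
  by ring.
rewrite /RN in x y *; elim: N.-1 x y => [|n IH] x y /=; first exact: sq.
by rewrite addrACA mulrDr lerD.
Qed.

(** If both norms were smaller than half of [euc_norm x], then [euc_sqnorm_sub] would give
    [euc_sqnorm x < euc_sqnorm x]. *)
Lemma euc_norm_sub_half N (x y : euc_car (RN R N)) :
  (euc_norm x / 2 <= euc_norm (euc_sub x y)) || (euc_norm x / 2 <= euc_norm y).
Proof.
rewrite -[_ || _]negbK negb_or -!ltNge; apply/negP => /andP[].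
have half0 : 0 <= euc_norm x / 2 by rewrite divr_ge0 ?sqrtr_ge0.
have lt_sqr (z : euc_car (RN R N)) : euc_norm z < euc_norm x / 2 ->
    euc_sqnorm z < euc_sqnorm x / 2 ^+ 2.
  rewrite -[X in is_true X -> _]ltr_sqr ?nnegrE ?sqrtr_ge0// /euc_norm expr_div_n.
  by rewrite !sqr_sqrtr ?euc_sqnorm_ge0.
move=> /lt_sqr lt1 /lt_sqr lt2.
by have := euc_sqnorm_sub N x y; lra.
Qed.

Lemma euc_norm_le N (x : euc_car (RN R N)) (r : R) : 0 <= r ->
  (euc_norm x <= r) = (euc_sqnorm x <= r ^+ 2).
Proof.
move=> r0; rewrite -(@ler_sqr _ (euc_norm x)) ?nnegrE ?sqrtr_ge0//.
by rewrite /euc_norm sqr_sqrtr ?euc_sqnorm_ge0.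
Qed.

Definition euc_ball N (r : R) : set (euc_car (RN R N)) :=
  [set x | euc_sqnorm x <= r ^+ 2].

Lemma measurable_euc_ball N (r : R) : measurable (euc_ball N r).
Proof.
have := measurable_euc_sqnorm N measurableT _ (measurable_itv `]-oo, r ^+ 2]).
by rewrite setTI; congr (measurable _); apply/seteqP; split => x /=;
   rewrite in_itv.
Qed.

(** The ball lies in a cube of side [2 * r]; only the order of growth in [r] matters later. *)
Lemma euc_ball_measure_le N (r : R) : 0 <= r -> (0 < N)%N ->
  (euc_leb (RN R N) (euc_ball N r) <= ((2 * r) ^+ N)%:E)%E.
Proof.
move=> r0 N0; rewrite -(prednK N0).
have itvE (x : R) : (x ^+ 2 <= r ^+ 2) = (x \in `[- r, r]).
  by rewrite in_itv /= -ler_norml -[x ^+ 2]real_normK ?num_real// ler_sqr ?nnegrE.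
have itvr : lebesgue_measure `[- r, r]%classic = (2 * r)%:E.
  rewrite lebesgue_measure_itv /= lte_fin; case: ltP => [_|r0'].
    by rewrite -EFinB opprK mulr2n mulrDl mul1r.
  by have -> : r = 0 by [lra]; rewrite mulr0.
have := measurable_euc_ball N.-1.+1 r.
rewrite /euc_ball /RN /=; elim: N.-1 => [|n IH] mB.
  by rewrite expr1 -itvr le_measure//= ?inE// => x /=; rewrite itvE.
have mBn := measurable_euc_ball n.+1 r.
have bigger : euc_ball n.+2 r `<=`
    (`[- r, r]%classic `*` euc_ball n.+1 r : set (euc_car (RN R n.+2))).
  move=> [x y]; have := euc_sqnorm_ge0 n.+1 y.
  rewrite /euc_ball /RN /= => y0 xy.
  split => /=; first by rewrite -itvE; apply: le_trans xy; rewrite lerDl.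
  by apply: le_trans xy; rewrite lerDr sqr_ge0.
apply: (le_trans (le_measure _ _ _ bigger)); rewrite ?inE//.
  by apply: measurableX.
rewrite /= product_measure2E// exprS EFinM.
apply: lee_pmul => //; last exact: IH.
by rewrite -itvr.
Qed.

Lemma sigma_finite_euc_leb N : (0 < N)%N -> sigma_finite setT (euc_leb (RN R N)).
Proof.
move=> N0; exists (fun n => euc_ball N n%:R).
  apply/seteqP; split=> // x _.
  exists (Num.bound (euc_norm x)) => //; rewrite /euc_ball /= -euc_norm_le//.
  by apply/ltW/archi_boundP/sqrtr_ge0.
move=> n; split; first exact: measurable_euc_ball.
by apply: le_lt_trans (euc_ball_measure_le _ _ _ _) (ltry _).
Qed.

End euclidean.

(** * Integrability *)

Section growth_bound.
Context (R : realType).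
Local Open Scope ereal_scope.

(* At [+oo] both sides are 0, since [fine +oo = 0] and [0 `^ (- 1) = 0]. *)
Lemma einvE (a : \bar R) : 0 < a -> einv a = (fine a `^ (- 1))%:E.
Proof.
case: a => [r| |] //=; last by rewrite powR0 ?oppr_eq0 ?oner_eq0.
by rewrite lte_fin => r0; rewrite gt_eqF// powR_inv1 ?ltW.
Qed.

Lemma einv_le (a : R) (b : \bar R) : (0 < a)%R -> a%:E <= b ->
  0 <= einv b <= a^-1%:E.
Proof.
move=> a0; case: b => [b| |] /=.
- rewrite lee_fin => ab; have b0 := lt_le_trans a0 ab.
  by rewrite gt_eqF// !lee_fin invr_ge0 (ltW b0) lef_pV2.
- by rewrite lexx lee_fin invr_ge0 (ltW a0).
- by rewrite leeNy_eq.
Qed.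

Lemma geometric_eseries_lty (a z : R) : (0 <= z < 1)%R ->
  \sum_(n <oo) (a * z ^+ n)%:E < +oo.
Proof.
move=> /andP[z0 z1].
have -> : (fun n => \sum_(0 <= i < n) (a * z ^+ i)%:E) =
    EFin \o series (geometric a z).
  by apply/funext => n; rewrite /series /= sumEFin.
rewrite EFin_lim; first exact: ltry.
by apply: is_cvg_geometric_series; rewrite ger0_norm.
Qed.

(** The least [n] with [t <= 2 ^+ n] works: minimality gives the lower bound when [n] is positive,
    and the maximum with 1 covers [n = 0]. *)
Lemma dyadic_shell (t : R) : (0 <= t)%R -> exists n,
  (t <= 2 ^+ n)%R /\ (2 ^+ n / 2 <= Num.max 1 t)%R.
Proof.
move=> t0; have [m tm] : exists m, (t <= 2 ^+ m)%R.
  exists (Num.bound t); apply: ltW; apply: lt_le_trans (archi_boundP t0) _.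
  by rewrite -natrX ler_nat ltnW// ltn_expl.
have ex : exists m, (t <= 2 ^+ m)%R by exists m.
exists (ex_minn ex); case: ex_minnP => -[|n] tn minn; split => //.
  by rewrite le_max; apply/orP; left; lra.
rewrite exprS mulrC mulKf ?pnatr_eq0// le_max; apply/orP; right.
by rewrite leNgt; apply/negP => /ltW /minn; rewrite ltnn.
Qed.

(** On the [n]-th shell the [p]-th power is at most [b n]. Full balls [B n] replace the shells in
    the dominating series, which leaves the geometric ratio unchanged. *)
Lemma inLp_einv (N : nat) (F k : euc_car (RN R N) -> \bar R) (c alpha p : R) :
  (0 < N)%N -> (0 < c)%R -> (0 < alpha)%R -> (1 <= p)%R ->
  (N%:R / alpha < p)%R ->
  measurable_fun setT k -> {ae euc_leb (RN R N), forall x, F x = k x} ->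
  (forall x, (c * Num.max 1 (euc_norm x) `^ alpha)%:E <= F x) ->
  inLp (fun x => einv (F x)) p.
Proof.
move=> N0 c0 a0 p1 Np mk Fk Fc; have p0 := lt_le_trans ltr01 p1.
set mu := euc_leb (RN R N).
pose e x := (fine (k x) `^ (- 1))%:E.
have me : measurable_fun setT e.
  apply/measurable_EFinP; apply: (measurableT_comp (measurable_powR _)).
  exact: (measurableT_comp (fine_measurable measurableT) mk).
have Fe : {ae mu, forall x, einv (F x) = e x}.
  apply: filterS Fk => x Fkx; rewrite einvE /e ?Fkx// -Fkx.
  apply: lt_le_trans (Fc x).
  by rewrite lte_fin mulr_gt0// powR_gt0// lt_max ltr01.
exists e; split => //.
have mekp : measurable_fun setT (fun x => `|e x| `^ p).
  by apply: (measurableT_comp (measurable_poweR _)); apply: measurableT_comp.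
pose b n := (((c * (2 ^+ n / 2) `^ alpha)^-1) `^ p)%R.
pose B n := euc_ball R N (2 ^+ n).
have mB n : measurable (B n) by exact: measurable_euc_ball.
have b0 n : (0 <= b n)%R by exact: powR_ge0.
pose u n x := (b n)%:E * (\1_(B n) x)%:E.
have u0 n x : 0 <= u n x by rewrite mule_ge0// lee_fin.
have meas_u n : measurable_fun setT (u n).
  apply: emeasurable_funM => //; apply/measurable_EFinP.
  exact: measurable_indic.
have le_u : {ae mu, forall x, setT x ->
    `|e x| `^ p <= \sum_(n <oo) u n x}.
  apply: filterS Fe => x Fex _; rewrite -Fex.
  have [n [xn nx]] := dyadic_shell (euc_norm x) (sqrtr_ge0 _).
  apply: (@le_trans _ _ (u n x)).
    rewrite /u indicE mem_set; last by rewrite /B /euc_ball /= -euc_norm_le.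
    rewrite mule1 /b -poweR_EFin.
    have pos : (0 < c * (2 ^+ n / 2) `^ alpha)%R.
      by rewrite mulr_gt0// powR_gt0// divr_gt0// exprn_gt0.
    have le1 : (c * (2 ^+ n / 2) `^ alpha)%:E <= F x.
      apply: le_trans (Fc x); rewrite lee_fin ler_pM2l// ge0_ler_powR//.
      - exact: ltW.
      - by rewrite nnegrE divr_ge0// exprn_ge0.
      - by rewrite nnegrE le_max ler01.
    have /andP[e0 ele] := einv_le _ _ pos le1.
    apply: gt0_ler_poweR => //; rewrite ?in_itv/= ?leey ?andbT ?abse_ge0//.
    - exact: ltW.
    - by rewrite lee_fin invr_ge0 ltW.
    - by rewrite gee0_abs.
  have := @nneseries_lim_ge R (u ^~ x) xpredT 0%N n.+1 (fun n _ _ => u0 n x).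
  apply: le_trans; rewrite big_nat_recr//= leeDr//.
  by apply: sume_ge0.
have int_lty : \int[mu]_x `|e x| `^ p < +oo.
  apply: (@le_lt_trans _ _ (\int[mu]_x \sum_(n <oo) u n x)).
    apply: ae_ge0_le_integral => //.
    - by move=> x _; exact: poweR_ge0.
    - by move=> x _; apply: nneseries_ge0.
    - exact: ge0_emeasurable_sum.
  rewrite integral_nneseries//.
  pose w := ((2 `^ alpha)^-1 `^ p)%R.
  pose K := ((c * 2^-1 `^ alpha)^-1 `^ p * 2 ^+ N)%R.
  apply: (@le_lt_trans _ _ (\sum_(n <oo) (K * (w * 2 ^+ N) ^+ n)%:E)); last first.
    apply: geometric_eseries_lty; apply/andP; split.
      by rewrite mulr_ge0// ?powR_ge0// exprn_ge0.
    rewrite /w -powRN -powRrM -powR_mulrn// -powRD; last by rewrite pnatr_eq0 implybT.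
    rewrite /powR pnatr_eq0 /= expR_lt1 pmulr_llt0 ?ln_gt0 ?ltr1n//.
    by move: Np; rewrite ltr_pdivrMr// mulNr addrC subr_lt0 mulrC.
  apply: lee_nneseries => [n _ _|n _]; first by apply: integral_ge0 => x _.
  rewrite /u ge0_integralZl//; last 2 first.
    by apply/measurable_EFinP; exact: measurable_indic.
    by rewrite lee_fin.
  rewrite integral_indic// setIT.
  apply: (@le_trans _ _ ((b n)%:E * ((2 * 2 ^+ n) ^+ N)%:E)).
    by apply: lee_wpmul2l; rewrite ?lee_fin// euc_ball_measure_le ?exprn_ge0.
  rewrite -EFinM lee_fin le_eqVlt; apply/orP; left; apply/eqP.
  have powRX (x s : R) m : (0 <= x -> (x ^+ m) `^ s = (x `^ s) ^+ m)%R.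
    by move=> x0; rewrite -!powR_mulrn ?powR_ge0// powRAC.
  have half0 : (0 <= 2^-1 :> R)%R by rewrite invr_ge0.
  have tw0 : (0 <= 2 `^ alpha :> R)%R by exact: powR_ge0.
  have -> : b n = ((c * 2^-1 `^ alpha)^-1 `^ p * w ^+ n)%R.
    rewrite /b [(2 ^+ n / 2)%R]mulrC powRM ?exprn_ge0// mulrA invfM powRM; last 2 first.
    - by rewrite invr_ge0 mulr_ge0 ?powR_ge0 ?ltW.
    - by rewrite invr_ge0 powR_ge0.
    by congr (_ * _)%R; rewrite powRX// -exprVn powRX// invr_ge0.
  rewrite /K !exprMn [in LHS]exprAC; move: (_ `^ p)%R (w ^+ n)%R => x y.
  by rewrite mulrACA.
by rewrite unlock; exact: poweR_lty.
Qed.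

End growth_bound.

(** * Lower bounds for the two convolutions *)

Lemma uniform_growth (R : realType) (T : Type) (nu : T -> R) (F : T -> \bar R)
    (c alpha delta M : R) : 0 < c -> 0 < alpha -> 0 < delta ->
  (forall x, (delta%:E <= F x)%E) ->
  (forall x, M <= nu x -> ((c * nu x `^ alpha)%:E <= F x)%E) ->
  exists2 c', 0 < c' &
    forall x, ((c' * Num.max 1 (nu x) `^ alpha)%:E <= F x)%E.
Proof.
move=> c0 a0 d0 Fd Fc; set L := Num.max 1 M.
have L0 : 0 < L `^ alpha by rewrite powR_gt0// lt_max ltr01.
(* Beyond [L] the growth hypothesis applies with constant [c]; below it [Num.max 1 (nu x)] is at
   most [L], so [delta] suffices. *)
exists (Num.min c (delta / L `^ alpha)); first by rewrite lt_min c0 divr_gt0.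
move=> x; have [Lx|xL] := leP L (nu x).
  have /andP[x1 xM] : (1 <= nu x) && (M <= nu x) by rewrite -ge_max.
  apply: le_trans (Fc x xM); rewrite lee_fin max_r//.
  by rewrite ler_wpM2r ?powR_ge0// ge_min lexx.
apply: le_trans (Fd x); rewrite lee_fin.
apply: (@le_trans _ _ (delta / L `^ alpha * L `^ alpha)).
  apply: ler_pM; rewrite ?powR_ge0//.
  - by rewrite le_min !ltW ?divr_gt0.
  - by rewrite ge_min lexx orbT.
  - apply: ge0_ler_powR; first exact: ltW.
    + by rewrite nnegrE le_max ler01.
    + by rewrite nnegrE le_max ler01.
    + by rewrite ge_max (ltW xL) andbT /L le_max lexx.
by rewrite divfK// gt_eqF.
Qed.

(** Common core of both claims: lower bounds uniform in [y] pass to the infimum over [y]. *)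
Lemma inLp_einv_infimum (R : realType) (N : nat)
    (h : euc_car (RN R N) * euc_car (RN R N) -> \bar R) (c alpha delta M p : R) :
  (0 < N)%N -> 0 < c -> 0 < alpha -> 0 < delta -> 1 <= p -> N%:R / alpha < p ->
  measurable_fun setT h ->
  (forall x y, (delta%:E <= h (x, y))%E) ->
  (forall x y, M <= euc_norm x ->
    ((c * euc_norm x `^ alpha)%:E <= h (x, y))%E) ->
  inLp (fun x => einv (ereal_inf [set h (x, y) | y in setT])) p.
Proof.
move=> N0 c0 a0 d0 p1 Np mh hd hc.
have [k [mk hk]] := measurable_infimum_ae _ _ _ _ _ _ _
  (sigma_finite_euc_leb R N N0) (baire_image_RN R N) mh.
have [c' c'0 hc'] : exists2 c', 0 < c' & forall w : _ * _,
    ((c' * Num.max 1 (euc_norm w.1) `^ alpha)%:E <= h w)%E.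
  by apply: (uniform_growth _ _ _ _ c alpha delta M) => // -[x y]; auto.
apply: (inLp_einv _ _ _ k c' alpha) => // x.
by apply: le_ereal_inf_tmp => _ [y _ <-]; exact: (hc' (x, y)).
Qed.

Lemma powR_eventually_ge (R : realType) (alpha L : R) : 0 < alpha -> 0 <= L ->
  exists2 t0 : R, 0 <= t0 & forall t, t0 <= t -> L <= t `^ alpha.
Proof.
move=> a0 L0; exists (L `^ alpha^-1) => [|t Lt]; first exact: powR_ge0.
rewrite -[leLHS](powRr1 L0) -(mulVf (lt0r_neq0 a0)) powRrM.
by apply: ge0_ler_powR => //; rewrite ?nnegrE ?powR_ge0 ?(le_trans _ Lt) ?powR_ge0// ltW.
Qed.

Theorem theorem22 (R : realType) (N : nat) (hN : (0 < N)%N)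
  (f g : euc_car (RN R N) -> \bar R)
  (mf : measurable_fun [set: euc_car (RN R N)] f)
  (mg : measurable_fun [set: euc_car (RN R N)] g)
  (f_gtNy : forall x, f x != -oo%E) (g_gtNy : forall x, g x != -oo%E)
  (c alpha : R) (c_gt0 : 0 < c) (alpha_gt0 : 0 < alpha)
  (growth : exists M : R, forall x : euc_car (RN R N),
      M <= euc_norm x ->
      ((c * euc_norm x `^ alpha)%:E <= f x)%E /\
      ((c * euc_norm x `^ alpha)%:E <= g x)%E) :
  let m_f := ereal_inf (range f) in
  let m_g := ereal_inf (range g) in
  let m_fp := ereal_inf (range (fun x => maxe (f x) 0%E)) in
  ((m_f \is a fin_num) -> (m_g \is a fin_num) -> (0 < m_f + m_g)%E ->
     forall p : R, 1 <= p -> N%:R / alpha < p ->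
       inLp (fun x => einv (infconv f g x)) p) /\
  ((forall x, (0 <= g x)%E) -> (0 < m_fp + m_g)%E ->
     forall p : R, 1 <= p -> N%:R / alpha < p ->
       inLp (fun x => einv (maxconv f g x)) p).
Proof.
move=> m_f m_g m_fp; have [M growthM] := growth.
have mfsub : measurable_fun setT
    (fun w : euc_car (RN R N) * euc_car (RN R N) => f (euc_sub w.1 w.2)).
  exact: (measurableT_comp mf (measurable_euc_sub R N)).
have mgsnd : measurable_fun setT
    (fun w : euc_car (RN R N) * euc_car (RN R N) => g w.2).
  exact: (measurableT_comp mg measurable_snd).
have fm x : (m_f <= f x)%E by apply: ereal_inf_lbound; exists x.
have gm x : (m_g <= g x)%E by apply: ereal_inf_lbound; exists x.
have half0 : 0 < 2^-1 `^ alpha :> R by rewrite powR_gt0// invr_gt0.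
have halfE (x : euc_car (RN R N)) : 2^-1 `^ alpha * euc_norm x `^ alpha = (euc_norm x / 2) `^ alpha.
  by rewrite mulrC powRM ?sqrtr_ge0// invr_ge0.
(* The threshold [2 * M] puts whichever of [euc_sub x y] and [y] has norm at least [euc_norm x / 2]
   in the growth region. *)
have far x y : 2 * M <= euc_norm x ->
    ((c * (euc_norm x / 2) `^ alpha)%:E <= f (euc_sub x y))%E \/
    ((c * (euc_norm x / 2) `^ alpha)%:E <= g y)%E.
  move=> Mx; have Mx2 : M <= euc_norm x / 2 by rewrite ler_pdivlMr// mulrC.
  have mono (z : euc_car (RN R N)) : euc_norm x / 2 <= euc_norm z ->
      ((c * (euc_norm x / 2) `^ alpha)%:E <= (c * euc_norm z `^ alpha)%:E)%E.
    move=> xz; rewrite lee_fin ler_pM2l// ge0_ler_powR ?(ltW alpha_gt0)//.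
      by rewrite nnegrE divr_ge0 ?sqrtr_ge0.
    by rewrite nnegrE sqrtr_ge0.
  have /orP[xy|xy] := euc_norm_sub_half R N x y; [left|right];
    apply: (le_trans (mono _ xy));
    by have [] := growthM _ (le_trans Mx2 xy).
split=> [mf_fin mg_fin m_gt0|g0 m_gt0] p p1 Np.
- have mfE := fineK mf_fin; have mgE := fineK mg_fin.
  pose L := `|fine m_f| + `|fine m_g|.
  have L0 : 0 <= 2 * L / c.
    by rewrite divr_ge0 ?mulr_ge0 ?addr_ge0// ltW.
  have [t0 t00 t0L] := powR_eventually_ge R alpha _ alpha_gt0 L0.
  apply: (inLp_einv_infimum R N
    (fun w => f (euc_sub w.1 w.2) + g w.2)%E (c / 2 * 2^-1 `^ alpha) alpha
    (fine (m_f + m_g)) (2 * Num.max M t0)) => //.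
  + by rewrite mulr_gt0// divr_gt0.
  + by rewrite fine_gt0// m_gt0 ltey_eq fin_numD mf_fin mg_fin.
  + exact: emeasurable_funD.
  + by move=> x y; rewrite fineK ?fin_numD ?mf_fin// leeD.
  + move=> x y /=; rewrite maxr_pMr// ge_max => /andP[Mx tx].
    rewrite -mulrA halfE; set s := (_ `^ _) in Mx *.
    have sL : L <= c / 2 * s.
      have : 2 * L / c <= s by apply: t0L; rewrite ler_pdivlMr// mulrC.
      by rewrite ler_pdivrMr//; lra.
    have [nf nfE] : - fine m_f <= L /\ - fine m_g <= L.
      by rewrite /L; have := ler_norm (- fine m_f); have := ler_norm (- fine m_g);
         rewrite !normrN => ? ?; split; [apply: ler_wpDr|apply: ler_wpDl].
    have [H|H] := far x y Mx.
      apply: le_trans (leeD H (gm y)); rewrite -mgE -EFinD lee_fin.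
      rewrite -/s; lra.
    apply: le_trans (leeD (fm _) H); rewrite -mfE -EFinD lee_fin.
    rewrite -/s; lra.
- have m0 : (0 < maxe m_fp m_g)%E.
    rewrite lt_max -[_ || _]negbK negb_or -!leNgt; apply/negP => /andP[fp0 gp0].
    by have := lt_le_trans m_gt0 (leeD fp0 gp0); rewrite adde0 ltxx.
  (* The maximum may be [+oo], whereas a real lower bound is needed. *)
  have [r /andP[r0 rm]] := ereal_rat_dense R _ _ m0.
  apply: (inLp_einv_infimum R N
    (fun w => maxe (f (euc_sub w.1 w.2)) (g w.2)) (c * 2^-1 `^ alpha) alpha
    (ratr r) (2 * M)) => //.
  + by rewrite mulr_gt0.
  + exact: measurable_maxe.
  (* Since [g] is nonnegative, replacing [g y] by 0 only lowers the maximum, which gives the bound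
     by [m_fp]. *)
  + move=> x y; apply: (le_trans (ltW rm)); rewrite ge_max /=; apply/andP; split.
      apply: (@le_trans _ _ (maxe (f (euc_sub x y)) 0%E)).
        by apply: ereal_inf_lbound; exists (euc_sub x y).
      by rewrite ge_max !le_max lexx g0 orbT.
    by rewrite le_max gm orbT.
  + move=> x y Mx; rewrite -mulrA halfE /= le_max; apply/orP.
    exact: far.
Qed.
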